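(* Let $h$ be a positive integer and let $(d; a)=(d_1,\ldots,d_c;a_0,\ldots,a_n)$ be an $h$-regular pair of tuples of positive integers with $c \ge 1$. If $a_i \nmid h$ for every $i=0,\ldots,n$ and $a_i \ne d_j$ for all $i,j$, then $$\delta(d;a):=\sum_{j=1}^c d_j-\sum_{i=0}^n a_i> 0.$$
   Context: Let $c\ge 0$, $n\ge -1$ be integers, $d=(d_1,\ldots,d_c)$ and $a=(a_0,\ldots,a_n)$ tuples of positive integers (possibly empty: $c=0$ or $n=-1$ is allowed in general). For a positive integer $h$, the pair $(d;a)$ is called $h$-regular if, for any subset $I=\{i_1,\ldots,i_k\}\subset\{0,\ldots,n\}$ (with $k$ elements, $k\geq 1$) such that $a_I:=\gcd(a_{i_1},\ldots,a_{i_k})>1$, one of the following holds: (i) there exist distinct integers $p_1,\ldots,p_k\in\{1,\ldots,c\}$ such that $a_I\mid d_{p_1},\ldots,d_{p_k}$; (ii) $a_I\mid h$. *)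

(* Defs.v *)
From HB Require Import structures.
From mathcomp Require Import all_boot all_order all_algebra.

Set Implicit Arguments.
Unset Strict Implicit.
Unset Printing Implicit Defensive.

Import Order.TTheory GRing.Theory Num.Theory.

(* A pair (d; a) = (d_1, ..., d_c; a_0, ..., a_n) is given by d : 'I_c -> nat
   and a : 'I_m -> nat, where m = n + 1, so that m = 0 is the case n = -1. *)

Definition gcd_on (m : nat) (a : 'I_m -> nat) (I : {set 'I_m}) : nat :=
  \big[gcdn/0%N]_(i in I) a i.

Definition regular_pair (h c m : nat) (d : 'I_c -> nat) (a : 'I_m -> nat) :
    Prop :=
  forall I : {set 'I_m}, (1 <= #|I|)%N -> (1 < gcd_on a I)%N ->
    (exists p : 'I_#|I| -> 'I_c,
       injective p /\ forall s : 'I_#|I|, (gcd_on a I %| d (p s))%N)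
    \/ (gcd_on a I %| h)%N.

Definition delta (c m : nat) (d : 'I_c -> nat) (a : 'I_m -> nat) : int :=
  (\sum_(j < c) (d j)%:Z - \sum_(i < m) (a i)%:Z)%R.

(* Main.v *)
Require Import Defs.
From HB Require Import structures.
From mathcomp Require Import all_boot all_order all_algebra all_field.

Set Implicit Arguments.
Unset Strict Implicit.
Unset Printing Implicit Defensive.

Import Order.TTheory GRing.Theory Num.Theory.

(** The [a_i] and [d_j] are compared by writing them as sums of nonnegative
    weights over roots of unity. Let [N] be a common multiple of all the
    [a_i] and [d_j], and give an [N]-th root of unity [x] the weight
    [|1 - x ^ h|^2], which is nonnegative and vanishes exactly when [x ^ h = 1].
    By orthogonality of the characters of a cyclic group, the total weight of
    the [n]-th roots of unity, for
    [n %| N], is [2 n] if [n] does not divide [h] and [0] if it does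
    ([sum_root_weight]). Exchanging sums, [2 * delta d a] is therefore at least
    the sum over [x] of the weight of [x] times the difference
      #{j : x ^ (d_j) = 1} - #{i : x ^ (a_i) = 1}
    (only at least, because a [d_j] dividing [h] contributes [0] instead of
    [2 d_j]). If [x] has order [e], these are the numbers of [d_j] and of [a_i]
    divisible by [e]; when [e] does not divide [h], regularity makes the
    difference nonnegative ([regular_pair_card]), and when [e] divides [h] the
    weight is zero.

    The inequality is strict because some term is positive (when there is no
    [a_i] at all, the claim is trivial): regularity applied to the
    largest [a_i] yields a proper multiple [e = d_j] of it
    ([regular_pair_large_degree]). This [e] does not divide [h] and exceeds
    every [a_i], so roots of order [e] have positive weight and are counted by
    [d_j] but by no [a_i]. *)

Section RootWeight.

Local Open Scope ring_scope.

Lemma sum_dvdn_mul (V : nmodType) (n q : nat) (F : nat -> V) :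
  (0 < q)%N ->
  \sum_(0 <= k < n * q | (q %| k)%N) F k = \sum_(0 <= l < n) F (l * q)%N.
Proof.
move=> q_gt0; elim: n => [|n IHn]; first by rewrite mul0n !big_geq.
rewrite big_nat_recr //= -IHn mulSn addnC.
rewrite (@big_cat_nat _ _ _ (n * q)) ?leq_addr //=; congr (_ + _).
rewrite big_ltn_cond ?dvdn_mull //; last by rewrite -[ltnLHS]addn0 ltn_add2l.
rewrite big_nat_cond big1 ?addr0 // => k /andP[/andP[lo hi]] /dvdnP[l def_k].
by move: lo hi; rewrite def_k -mulSnr !ltn_pmul2r // => lo; rewrite ltnS leqNgt lo.
Qed.

Lemma geom_sum_root (R : idomainType) (x : R) (n : nat) :
  x ^+ n = 1 -> x != 1 -> \sum_(l < n) x ^+ l = 0.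
Proof.
move=> xn1; rewrite -subr_eq0 => x_neq1; apply: (mulfI x_neq1).
by rewrite mulr0 -subrX1 xn1 subrr.
Qed.

Lemma norm_root_unity (C : numClosedFieldType) (x : C) (n : nat) :
  (0 < n)%N -> x ^+ n = 1 -> `|x| = 1.
Proof.
move=> n_gt0 xn1; apply/eqP; rewrite -(@pexpr_eq1 _ _ n) //.
by rewrite -normrX xn1 normr1.
Qed.

Lemma sum_norm_sub_root (C : numClosedFieldType) (x : C) (n : nat) :
  (0 < n)%N -> x ^+ n = 1 -> x != 1 ->
  \sum_(l < n) `|1 - x ^+ l| ^+ 2 = (2 * n)%:R.
Proof.
move=> n_gt0 xn1 x_neq1; have sum0 := geom_sum_root xn1 x_neq1.
have sumC0 : \sum_(l < n) (x ^+ l)^* = 0 by rewrite -rmorph_sum /= sum0 rmorph0.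
have termE (l : nat) : `|1 - x ^+ l| ^+ 2 = 2 - x ^+ l - (x ^+ l)^*.
  have normX : x ^+ l * (x ^+ l)^* = 1.
    by rewrite -normCK normrX (norm_root_unity n_gt0 xn1) !expr1n.
  rewrite normCK rmorphB rmorph1 mulrBr mulr1 mulrBl mul1r normX.
  by rewrite opprB addrACA addrA.
rewrite (eq_bigr _ (fun (l : 'I_n) _ => termE l)) !sumrB sum0 sumC0 !subr0.
by rewrite sumr_const card_ord natrM mulr_natr.
Qed.

(** The weight of the [N]-th root of unity [z ^ k], where [z] is primitive. *)
Definition root_weight (C : numClosedFieldType) (z : C) (h k : nat) : C :=
  `|1 - z ^+ (k * h)| ^+ 2.

Lemma root_weight_ge0 (C : numClosedFieldType) (z : C) (h k : nat) :
  0 <= root_weight z h k.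
Proof. by rewrite exprn_ge0. Qed.

Lemma root_weight_eq0 (C : numClosedFieldType) (z : C) (N h k : nat) :
  N.-primitive_root z -> (root_weight z h k == 0) = (N %| k * h)%N.
Proof.
move=> zN; rewrite /root_weight expf_eq0 /= normr_eq0 subr_eq0 eq_sym.
by rewrite (prim_order_dvd zN).
Qed.

(** The condition [N %| k * n] says that [z ^ k] is an [n]-th root of unity. *)
Lemma sum_root_weight (C : numClosedFieldType) (z : C) (N h n : nat) :
  N.-primitive_root z -> (n %| N)%N ->
  \sum_(k < N | (N %| k * n)%N) root_weight z h k =
  (if (n %| h)%N then 0 else 2 * n)%:R.
Proof.
move=> zN n_dvd_N; have N_gt0 := prim_order_gt0 zN.
have [q def_N] := dvdnP n_dvd_N.
have [q_gt0 n_gt0] : (0 < q)%N /\ (0 < n)%N.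
  by apply/andP; rewrite -muln_gt0 -def_N.
pose x := z ^+ (q * h).
have xn1 : x ^+ n = 1.
  by rewrite -exprM mulnAC -def_N exprM (prim_expr_order zN) expr1n.
have x_eq1 : (x == 1) = (n %| h)%N.
  by rewrite -(prim_order_dvd zN) def_N dvdn_pmul2l.
have -> : \sum_(k < N | (N %| k * n)%N) root_weight z h k =
          \sum_(l < n) `|1 - x ^+ l| ^+ 2.
  rewrite -(big_mkord (fun k => (N %| k * n)%N) (root_weight z h)).
  rewrite (eq_bigl (fun k => (q %| k)%N)) => [|k]; last first.
    by rewrite {1}def_N dvdn_pmul2r.
  rewrite def_N mulnC sum_dvdn_mul // big_mkord; apply: eq_bigr => l _.
  by rewrite /root_weight -exprM -mulnA [(l * _)%N]mulnC.
case: ifP => n_dvd_h; last by rewrite sum_norm_sub_root // x_eq1 n_dvd_h.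
move: x_eq1; rewrite n_dvd_h => /eqP ->.
by rewrite big1 // => l _; rewrite expr1n subrr normr0 expr0n.
Qed.

End RootWeight.

(** If [z] is a primitive [N]-th root of unity, then [N %/ gcdn N k] is the
    order of [z ^ k]. *)
Lemma dvdn_mul_gcd (N k n : nat) :
  0 < N -> (N %| k * n) = (N %/ gcdn N k %| n).
Proof.
move=> N_gt0; have g_gt0 : 0 < gcdn N k by rewrite gcdn_gt0 N_gt0.
set g := gcdn N k.
have -> : (N %| k * n) = (N %/ g * g %| k %/ g * g * n).
  by rewrite !divnK ?dvdn_gcdl ?dvdn_gcdr.
rewrite mulnAC dvdn_pmul2r // Gauss_dvdr //.
rewrite /coprime -(eqn_pmul2r g_gt0) mul1n muln_gcdl.
by rewrite !divnK ?dvdn_gcdl ?dvdn_gcdr.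
Qed.

Section RegularPair.

Variables (h c m : nat) (d : 'I_c -> nat) (a : 'I_m -> nat).
Hypotheses (a_gt0 : forall i, 0 < a i) (reg : regular_pair h d a).

(** The only form in which regularity is used: the multiples of [e] among the
    [a_i] have a gcd that is again a multiple of [e], hence does not divide
    [h], so regularity injects them into the multiples of [e] among the
    [d_j]. *)
Lemma regular_pair_card (e : nat) :
  ~~ (e %| h) -> #|[set i | e %| a i]| <= #|[set j | e %| d j]|.
Proof.
move=> e_ndvd; set I := [set i | e %| a i].
have [->|/set0Pn[i0 i0I]] := eqVneq I set0; first by rewrite cards0.
have e_dvd : e %| gcd_on a I by apply/dvdn_biggcdP => i; rewrite inE.
have g_dvd : gcd_on a I %| a i0 by apply: (@biggcdn_inf _ i0 (fun i => i \in I)).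
have g_ndvd : ~~ (gcd_on a I %| h) by apply: contra e_ndvd; apply: dvdn_trans.
have g_gt1 : 1 < gcd_on a I.
  rewrite ltn_neqAle (dvdn_gt0 (a_gt0 i0) g_dvd) andbT.
  by apply: contraNneq g_ndvd => <-; rewrite dvd1n.
have I_gt0 : 1 <= #|I| by apply/card_gt0P; exists i0.
have [[p [p_inj p_dvd]]|] := reg I_gt0 g_gt1; last by rewrite (negbTE g_ndvd).
rewrite -[leqLHS]card_ord -cardsT -(card_imset _ p_inj) subset_leq_card //.
apply/subsetP => _ /imsetP[s _ ->].
by rewrite inE (dvdn_trans e_dvd (p_dvd s)).
Qed.

Hypotheses (d_gt0 : forall j, 0 < d j) (a_ndvd_h : forall i, ~~ (a i %| h)).
Hypothesis a_neq_d : forall i j, a i <> d j.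

Lemma regular_pair_large_degree :
  0 < m -> exists j, ~~ (d j %| h) /\ forall i, a i < d j.
Proof.
move=> m_gt0; case: (@arg_maxnP _ (Ordinal m_gt0) xpredT a) => // i _ a_max.
have := regular_pair_card (a_ndvd_h i).
have: 0 < #|[set i' | a i %| a i']| by apply/card_gt0P; exists i; rewrite inE.
move=> lt0 /(leq_trans lt0)/card_gt0P[j]; rewrite inE => ai_dvd; exists j.
split=> [|i']; first by apply: contra (a_ndvd_h i); apply: dvdn_trans.
apply: leq_ltn_trans (a_max i' isT) _.
by rewrite ltn_neqAle dvdn_leq // andbT; apply/eqP/a_neq_d.
Qed.

Lemma regular_pair_sum_lt : 0 < c -> \sum_i a i < \sum_j d j.
Proof.
move=> c_gt0; have [m_eq0|m_gt0] := posnP m.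
  rewrite [ltnLHS]big1 => [|[i lt_im]]; last by exfalso; move: lt_im; rewrite m_eq0.
  by rewrite (bigD1 (Ordinal c_gt0)) //= addn_gt0 d_gt0.
have [j0 [d_ndvd a_lt]] := regular_pair_large_degree m_gt0.
pose N := (\prod_i a i) * \prod_j d j.
have N_gt0 : 0 < N by rewrite muln_gt0 !prodn_gt0.
have a_dvd i : a i %| N by rewrite dvdn_mulr // (bigD1 i) //= dvdn_mulr.
have d_dvd j : d j %| N by rewrite dvdn_mull // (bigD1 j) //= dvdn_mulr.
have [z zN] := C_prim_root_exists N_gt0.
pose A k := #|[set i | N %| k * a i]|; pose D k := #|[set j | N %| k * d j]|.
pose W := root_weight z h.
have sumE (J : finType) (b : J -> nat) : (forall j, b j %| N) ->
    (\sum_j (if b j %| h then 0 else 2 * b j)%N%:R =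
     \sum_(k < N) W k *+ #|[set j | (N %| k * b j)%N]|)%R.
  move=> b_dvd.
  rewrite (eq_bigr _ (fun j _ => esym (sum_root_weight h zN (b_dvd j)))).
  rewrite (exchange_big_dep xpredT) //=; apply: eq_bigr => k _.
  by rewrite -sumr_const; apply: eq_bigl => j; rewrite inE.
have W_AD k : (W k *+ A k <= W k *+ D k)%R.
  have [/eqP W0|W_neq0] := boolP (W k == 0%R); first by rewrite W0 !mul0rn.
  apply: ler_wpMn2l; first exact: root_weight_ge0.
  have e_ndvd : ~~ (N %/ gcdn N k %| h).
    by rewrite -dvdn_mul_gcd // -(root_weight_eq0 _ _ zN).
  suff cardE (J : finType) (b : J -> nat) :
      #|[set j | N %| k * b j]| = #|[set j | N %/ gcdn N k %| b j]|.
    by rewrite /A /D !cardE regular_pair_card.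
  by apply: eq_card => j; rewrite !inE dvdn_mul_gcd.
(* [z ^ k0] is a root of unity of order exactly [d j0]. *)
have q_gt0 : 0 < N %/ d j0 by rewrite divn_gt0 // dvdn_leq.
have lt_k0 : N %/ d j0 < N.
  by apply: ltn_Pdiv => //; apply: leq_ltn_trans (a_lt (Ordinal m_gt0)).
pose k0 := Ordinal lt_k0.
have k0E n : (N %| k0 * n) = (d j0 %| n).
  by rewrite /= -{1}(divnK (d_dvd j0)) dvdn_pmul2l.
have W_k0 : (W k0 *+ A k0 < W k0 *+ D k0)%R.
  have -> : A k0 = 0.
    apply: eq_card0 => i; rewrite !inE k0E; apply/negbTE.
    by apply: contraL (a_lt i) => /(dvdn_leq (a_gt0 i)); rewrite leqNgt.
  rewrite mulr0n pmulrn_lgt0.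
    by rewrite lt0r root_weight_ge0 (root_weight_eq0 _ _ zN) k0E d_ndvd.
  by apply/card_gt0P; exists j0; rewrite inE k0E.
have sum_lt : (\sum_(k < N) W k *+ A k < \sum_(k < N) W k *+ D k)%R.
  by rewrite (bigD1 k0) //= [ltRHS](bigD1 k0) //= ltr_leD // ler_sum.
move: sum_lt; rewrite -!sumE // -!natr_sum ltr_nat => lt2.
rewrite -(@ltn_pmul2l 2) // !big_distrr /=.
rewrite (eq_bigr (fun i => if a i %| h then 0 else 2 * a i)) => [|i _]; last first.
  by rewrite (negbTE (a_ndvd_h i)).
(* Each [d j] dividing [h] has total weight [0 <= 2 * d j]. *)
by apply: leq_trans lt2 _; apply: leq_sum => j _; case: ifP.
Qed.

End RegularPair.

Theorem proposition5p12 (h c m : nat) (d : 'I_c -> nat) (a : 'I_m -> nat)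
  (h_gt0 : (0 < h)%N) (c_ge1 : (1 <= c)%N)
  (d_gt0 : forall j : 'I_c, (0 < d j)%N)
  (a_gt0 : forall i : 'I_m, (0 < a i)%N)
  (reg : regular_pair h d a)
  (a_ndvd_h : forall i : 'I_m, ~~ (a i %| h)%N)
  (a_neq_d : forall (i : 'I_m) (j : 'I_c), a i <> d j) :
  (0 < delta d a)%R.
Proof.
rewrite /delta subr_gt0 -!(rmorph_sum Posz) /= ltz_nat.
exact: (regular_pair_sum_lt a_gt0 reg).
Qed.
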